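(* Let $(\varphi,\psi)$ be a pair of kernels such that $M_1(\varphi)+\tilde M_1(\psi)<+\infty$, and let $f\in C(\mathbb{R})$. Then $$\lVert S_w^{\varphi,\psi}f-f\rVert_\infty\le C^{\varphi,\psi}\,\omega\left(f,\frac1w\right)\qquad\text{for every } w>0,$$ where $C^{\varphi,\psi}=M_0(\varphi)\left(\tilde M_0(\psi)+\tilde M_1(\psi)\right)+M_1(\varphi)\tilde M_0(\psi)$.
   Context: $C(\mathbb{R})$ denotes the space of all uniformly continuous and bounded functions $f:\mathbb{R}\to\mathbb{R}$, $\lVert\cdot\rVert_\infty$ is the sup norm, and for $\delta>0$ $$\omega(f,\delta):=\sup\{|f(x)-f(y)|:\ |x-y|<\delta,\ x,y\in\mathbb{R}\}.$$ For $g:\mathbb{R}\to\mathbb{R}$ and $\nu\ge 0$ put $$M_\nu(g):=\sup_{u\in\mathbb{R}}\sum_{k\in\mathbb{Z}}|g(u-k)|\,|u-k|^\nu,\qquad \tilde M_\nu(g):=\int_{\mathbb{R}}|t|^\nu|g(t)|\,dt.$$ A pair of kernels $(\varphi,\psi)$ is a pair of functions $\varphi,\psi:\mathbb{R}\to\mathbb{R}$ in $L^1(\mathbb{R})$ such that: $\varphi$ is bounded in a neighborhood of the origin; $\sum_{k\in\mathbb{Z}}\varphi(u-k)=1$ for every $u\in\mathbb{R}$; $\int_{\mathbb{R}}\psi(u)\,du=1$; and there exists $r>0$ with $M_r(\varphi)<+\infty$. (Under these assumptions $M_0(\varphi)<+\infty$.) The Durrmeyer sampling operators are, for $w>0$ and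 any $f$ for which the series converges for every $x$, $$(S_w^{\varphi,\psi}f)(x)=\sum_{k\in\mathbb{Z}}\varphi(wx-k)\,w\int_{\mathbb{R}}\psi(wu-k)f(u)\,du,\qquad x\in\mathbb{R}.$$ *)

(* Defs.v *)
From HB Require Import structures.
From mathcomp Require Import all_boot all_order all_algebra.
From mathcomp Require Import finmap.
From mathcomp Require Import all_classical all_reals all_analysis.
From mathcomp.analysis.showcase Require summability.

Set Implicit Arguments.
Unset Strict Implicit.
Unset Printing Implicit Defensive.

Import Order.TTheory GRing.Theory Num.Theory.
Import numFieldNormedType.Exports.

Local Open Scope classical_set_scope.
Local Open Scope ring_scope.

(* Integrals are taken with respect to [completed_lebesgue_measure], that is,
   for Lebesgue-measurable and not only Borel-measurable integrands. *)
Definition L1 (R : realType) (g : R -> R) : Prop :=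
  (@completed_lebesgue_measure R).-integrable setT (fun t : R => (g t)%:E).

Definition bounded_unif_continuous (R : realType) (f : R -> R) : Prop :=
  unif_continuous f /\ bounded_fun f.

Definition sup_norm (R : realType) (h : R -> R) : \bar R :=
  ereal_sup [set (`|h x|)%:E | x in [set: R]].

Definition modulus (R : realType) (f : R -> R) (delta : R) : \bar R :=
  ereal_sup [set (`|f p.1 - f p.2|)%:E | p in [set p : R * R | `|p.1 - p.2| < delta]].

(* [powR] satisfies [0 `^ 0 = 1], so for [nu = 0] the weight is constantly 1. *)
Definition discrete_moment (R : realType) (nu : R) (g : R -> R) : \bar R :=
  ereal_sup [set \esum_(k in [set: int])
    (`|g (u - k%:~R)| * `|u - k%:~R| `^ nu)%:E | u in [set: R]].

Definition continuous_moment (R : realType) (nu : R) (g : R -> R) : \bar R :=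
  (\int[@completed_lebesgue_measure R]_(t in [set: R]) (`|t| `^ nu * `|g t|)%:E)%E.

(* Series over the integers are unordered sums, i.e., limits of finite partial
   sums along the filter of finite subsets ordered by inclusion; over the reals
   this is the same as absolute convergence. In [pair_of_kernels] nothing is
   lost with respect to other summation orders: [pok_bounded] and [pok_moment]
   already make the series of [pok_sum] absolutely convergent. *)
Definition Zpartial_sum (R : realType) (a : int -> R) : {fset int} -> R :=
  summability.partial_sum a.

Definition Zsummable (R : realType) (a : int -> R) : Prop :=
  cvg (Zpartial_sum a @ summability.totally).

Definition Zsum (R : realType) (a : int -> R) : R :=
  lim (Zpartial_sum a @ summability.totally).

Record pair_of_kernels (R : realType) (phi psi : R -> R) : Prop := {
  pok_phi_L1 : L1 phi ;
  pok_psi_L1 : L1 psi ;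
  pok_bounded : bounded_near phi (nbhs (0 : R)) ;
  pok_sum : forall u : R,
    Zpartial_sum (fun k => phi (u - k%:~R)) @ summability.totally --> (1 : R) ;
  pok_int : (\int[@completed_lebesgue_measure R]_(u in [set: R]) (psi u)%:E = 1)%E ;
  pok_moment : exists2 r : R, 0 < r & (discrete_moment r phi < +oo)%E }.

Definition durrmeyer_term (R : realType) (phi psi : R -> R) (w : R)
    (f : R -> R) (x : R) (k : int) : R :=
  phi (w * x - k%:~R) *
  (w * (\int[@completed_lebesgue_measure R]_(u in [set: R])
          (psi (w * u - k%:~R) * f u))%R).

(* The domain of the operator: outside of it [durrmeyer] is a default value. *)
Definition durrmeyer_defined (R : realType) (phi psi : R -> R) (w : R)
    (f : R -> R) : Prop :=
  (forall k : int, L1 (fun u => psi (w * u - k%:~R) * f u)) /\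
  (forall x : R, Zsummable (durrmeyer_term phi psi w f x)).

Definition durrmeyer (R : realType) (phi psi : R -> R) (w : R)
    (f : R -> R) (x : R) : R :=
  Zsum (durrmeyer_term phi psi w f x).

Definition durrmeyer_const (R : realType) (phi psi : R -> R) : \bar R :=
  (discrete_moment 0 phi * (continuous_moment 0 psi + continuous_moment 1 psi)
   + discrete_moment 1 phi * continuous_moment 0 psi)%E.

(* Main.v *)
Require Import Defs.
From HB Require Import structures.
From mathcomp Require Import all_boot all_order all_algebra.
From mathcomp Require Import finmap zify ring lra.
From mathcomp Require Import all_classical all_reals all_analysis.
From mathcomp Require Import measurable_realfun.

(** The operator averages f around x. Substituting t = w u - k turns the k-th
    integral into the average A_k of f against psi dilated to scale 1/w and
    centred at k/w, so that the series is the sum of phi(w x - k) A_k. Both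
    families of weights have total mass one (the series of the phi(w x - k) and
    the integral of psi), hence

      S f(x) - f(x) = sum_k phi(w x - k) int psi(t) (f((t+k)/w) - f(x)) dt.

    Cutting a segment into pieces shorter than 1/w gives
    |f(y) - f(x)| <= (1 + w |y - x|) omega(f, 1/w) ([distr_le_modulus]), and for
    y = (t+k)/w one has w |y - x| <= |t| + |w x - k|. Integrating against |psi|
    ([kernel_average_dist]) and summing against |phi(w x - k)| leaves exactly
    the moments of order 0 and 1 that form the constant.

    Two points need work. The first is the substitution for integrands that are
    only Lebesgue measurable. The completed measure is the outer measure
    generated by lengths of half-open intervals, and these lengths scale under
    affine maps, so the outer measure of every set scales
    ([completed_lebesgue_measure_affine]); the measurability of affine maps
    follows from this, since Caratheodory measurability is expressed by the
    outer measure alone. The second is the absolute convergence of the series.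
    For a fixed u only the at most two integers with |u - k| < 1 escape the
    estimate |phi(u - k)| <= |phi(u - k)| |u - k|, so the finiteness of the
    moment of order 1 makes the series of order 0 at u finite
    ([esum_moment0_fin]). The estimate is made at each x with the finite sums at
    u = w x, and their suprema over u enter only in the last comparison of
    extended reals. *)

Set Implicit Arguments.
Unset Strict Implicit.
Unset Printing Implicit Defensive.

Import Order.TTheory GRing.Theory Num.Theory.
Import numFieldNormedType.Exports.

Local Open Scope classical_set_scope.
Local Open Scope ring_scope.

#[local] Existing Instance summability.totally_filter.

(** * Affine substitution for the completed Lebesgue measure *)

Section affine_change_of_variable.
Context {R : realType}.
Local Notation mu := (@completed_lebesgue_measure R).
Local Notation T := (caratheodory_type ((wlength (@idfun R))^*)%mu).

Definition affine_map (a b x : R) : R := a * x + b.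

Lemma affine_mapVK (a b : R) : a != 0 ->
  cancel (affine_map a^-1 (- (a^-1 * b))) (affine_map a b).
Proof.
by move=> a0 x; rewrite /affine_map mulrDr mulVKf// mulrN mulVKf// subrK.
Qed.

Lemma affine_mapK (a b : R) : a != 0 ->
  cancel (affine_map a b) (affine_map a^-1 (- (a^-1 * b))).
Proof. by move=> a0 x; rewrite /affine_map mulrDr mulKf// addrK. Qed.

Lemma preimage_affine_ocitv (a b : R) (X : set R) : 0 < a -> ocitv X ->
  ocitv (affine_map a b @^-1` X) /\
  wlength idfun (affine_map a b @^-1` X) = (a^-1%:E * wlength idfun X)%E.
Proof.
move=> a0 [[x y] _ <-] /=.
have -> : affine_map a b @^-1` `]x, y] = `](x - b) / a, (y - b) / a]%classic.
  apply/seteqP; split => t /=; rewrite !in_itv/= /affine_map;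
  by rewrite ltr_pdivrMr// ler_pdivlMr// ltrBlDr lerBrDr mulrC.
split; first by exists ((x - b) / a, (y - b) / a).
rewrite !wlength_itv/= !lte_fin ltr_pM2r ?invr_gt0// ltrD2r.
case: ifPn => _; last by rewrite mule0.
by rewrite -!EFinD -EFinM; congr EFin; ring.
Qed.

(** The preimages of a cover of [A] by half-open intervals cover the preimage
    of [A], with all lengths divided by [a]. *)
Lemma le_completed_lebesgue_measure_affine (a b : R) (A : set R) : 0 < a ->
  (mu (affine_map a b @^-1` A) <= a^-1%:E * mu A)%E.
Proof.
move=> a0.
rewrite muleC lee_pdivlMr// muleC.
apply: le_ereal_inf_tmp => _ [F [mF AF] <-].
rewrite -lee_pdivlMl// -nneseriesZl; last first.
  by move=> i _; exact: wlength_ge0.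
apply: ereal_inf_lbound; exists (fun i => affine_map a b @^-1` F i).
  split; first by move=> i; exact: (preimage_affine_ocitv b a0 (mF i)).1.
  by move=> x /AF[i _ Fix]; exists i.
by apply: eq_eseriesr => i _; exact: (preimage_affine_ocitv b a0 (mF i)).2.
Qed.

(** [A] is arbitrary, as the measure is defined as an outer measure on all
    sets. The reverse inequality is [le_completed_lebesgue_measure_affine] for
    the inverse map. *)
Lemma completed_lebesgue_measure_affine (a b : R) (A : set R) : 0 < a ->
  mu (affine_map a b @^-1` A) = (a^-1%:E * mu A)%E.
Proof.
move=> a0; have a_neq0 := lt0r_neq0 a0.
apply/eqP; rewrite eq_le le_completed_lebesgue_measure_affine//=.
rewrite lee_pdivrMl//.
have av0 : 0 < a^-1 by rewrite invr_gt0.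
have := le_completed_lebesgue_measure_affine (- (a^-1 * b))
  (affine_map a b @^-1` A) av0.
rewrite invrK -comp_preimage; congr (mu _ <= _)%E.
by apply/funext => x /=; rewrite affine_mapVK.
Qed.

(** A bijection that scales the outer measure of every set by the same factor
    transports the Caratheodory splitting condition. This covers Lebesgue
    measurable sets, for which continuity of the map would not be enough. *)
Lemma measurable_affine_map (a b : R) : 0 < a ->
  measurable_fun [set: T] (affine_map a b : T -> T).
Proof.
move=> a0 _ A mA; rewrite setTI.
(* The measurable sets of [T] are by definition the Caratheodory ones. *)
change (caratheodory_measurable ((wlength (@idfun R))^*)%mu
  (affine_map a b @^-1` A)).
move=> X.
have a_neq0 := lt0r_neq0 a0.
have [Y ->] : exists Y, X = affine_map a b @^-1` Y.
  exists (affine_map a^-1 (- (a^-1 * b)) @^-1` X).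
  by apply/funext => x /=; rewrite affine_mapK.
have h B : ((wlength (@idfun R))^*)%mu (affine_map a b @^-1` B) =
  (a^-1%:E * ((wlength (@idfun R))^*)%mu B)%E.
  exact: completed_lebesgue_measure_affine.
(* The two pieces of the test set are the preimages of those that [A] cuts out
   of [Y]. *)
have hA := h (Y `&` A); have hnA := h (Y `&` ~` A).
rewrite preimage_setI in hA; rewrite preimage_setI -preimage_setC in hnA.
rewrite hA hnA h -ge0_muleDr; [|exact: outer_measure_ge0..].
by congr (_ * _)%E; exact: mA.
Qed.

Lemma ge0_integral_affine (a b : R) (g : R -> \bar R) : 0 < a ->
  measurable_fun [set: T] g -> (forall x, 0 <= g x)%E ->
  (\int[mu]_x g (affine_map a b x) = a^-1%:E * \int[mu]_x g x)%E.
Proof.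
move=> a0 mg g0.
have av0 : 0 <= a^-1 by rewrite invr_ge0 ltW.
transitivity (\int[pushforward mu (affine_map a b : T -> T)]_x g x)%E.
  by rewrite (ge0_integral_pushforward (measurable_affine_map b a0)).
transitivity (\int[mscale (NngNum av0) mu]_x g x)%E; last first.
  by rewrite ge0_integral_mscale.
pose m_aff := isMeasurableFun.Build _ _ T T _ (measurable_affine_map b a0).
pose aff : {mfun T >-> T} := HB.pack (affine_map a b : T -> T) m_aff.
apply: (@eq_measure_integral _ T R setT (mscale (NngNum av0) mu)
  (pushforward mu aff)) => A mA _.
exact: completed_lebesgue_measure_affine.
Qed.

Lemma L1_affine (a b : R) (g : R -> R) : 0 < a ->
  L1 g -> L1 (g \o affine_map a b).
Proof.
move=> a0 /integrableP[mg ig]; apply/integrableP; split.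
  exact: measurableT_comp mg (measurable_affine_map b a0).
have mabs : measurable_fun [set: T] (fun x : T => `|(g x)%:E|%E).
  exact: measurableT_comp.
rewrite /= (@ge0_integral_affine a b (fun x => `|(g x)%:E|%E))//.
by rewrite lte_mul_pinfty// lee_fin invr_ge0 ltW.
Qed.

Lemma Rintegral_affine (a b : R) (g : R -> R) : 0 < a -> L1 g ->
  a * (\int[mu]_x g (affine_map a b x))%R = (\int[mu]_x g x)%R.
Proof.
move=> a0 Lg; have /integrableP[mg ig] := Lg.
have Lga := L1_affine b a0 Lg.
have gpos : (\int[mu]_x (fun y => (g y)%:E)^\+ x)%E \is a fin_num.
  exact: integrable_pos_fin_num.
have gneg : (\int[mu]_x (fun y => (g y)%:E)^\- x)%E \is a fin_num.
  exact: integrable_neg_fin_num.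
rewrite /Rintegral [in LHS]integralE [in RHS]integralE.
have epos : (\int[mu]_x (fun y => (g (affine_map a b y))%:E)^\+ x =
    a^-1%:E * \int[mu]_x (fun y => (g y)%:E)^\+ x)%E.
  rewrite -(@ge0_integral_affine a b (fun y => (g y)%:E)^\+%E)//.
    by rewrite unlock.
  exact: measurable_funepos.
have eneg : (\int[mu]_x (fun y => (g (affine_map a b y))%:E)^\- x =
    a^-1%:E * \int[mu]_x (fun y => (g y)%:E)^\- x)%E.
  rewrite -(@ge0_integral_affine a b (fun y => (g y)%:E)^\-%E)//.
    by rewrite unlock.
  exact: measurable_funeneg.
rewrite epos eneg.
have cancel_a (p n : \bar R) : p \is a fin_num -> n \is a fin_num ->
    a * fine (a^-1%:E * p - a^-1%:E * n)%E = fine (p - n)%E.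
  case: p => [p||]//; case: n => [n||]//= _ _.
  by rewrite -mulrBr mulVKf// lt0r_neq0.
exact: cancel_a.
Qed.

End affine_change_of_variable.

(** * The modulus of continuity *)

Section modulus_of_continuity.
Context {R : realType}.
Implicit Types (f : R -> R) (d x y h : R).

Lemma unif_continuous_continuous f : unif_continuous f -> continuous f.
Proof.
move=> uf x A /nbhsP[E /uf entE EA].
have := nbhs_entourage x entE.
apply: filterS => y; rewrite /= /xsection/= inE => Exy.
by apply: EA; rewrite /xsection/= inE.
Qed.

Lemma bounded_fun_le f : bounded_fun f ->
  exists M : R, forall x : R, `|f x| <= M.
Proof.
move=> [M [_ hM]]; exists (M + 1) => x.
by apply: (hM (M + 1)) => //; rewrite ltrDl.
Qed.

Lemma le_modulus f d x y : `|x - y| < d -> (`|f x - f y|%:E <= modulus f d)%E.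
Proof. by move=> xyd; apply: ereal_sup_ubound; exists (x, y). Qed.

Lemma modulus_ge0 f d : 0 < d -> (0 <= modulus f d)%E.
Proof.
move=> d0; have := @le_modulus f d 0 0; rewrite !subrr normr0; exact.
Qed.

Lemma modulus_fin_num f d : 0 < d -> bounded_fun f ->
  modulus f d \is a fin_num.
Proof.
move=> d0 /bounded_fun_le[M fM].
rewrite ge0_fin_numE ?modulus_ge0//.
apply: (@le_lt_trans _ _ (M + M)%:E); last exact: ltry.
apply: ge_ereal_sup => _ [[x y] _ <-]/=; rewrite lee_fin.
by rewrite (le_trans (ler_normB _ _))// lerD.
Qed.

Lemma chain_le_modulus f d h x n : bounded_fun f -> 0 < d -> `|h| < d ->
  `|f (x + n%:R * h) - f x| <= n%:R * fine (modulus f d).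
Proof.
move=> bf d0 hd; elim: n => [|n IH]; first by rewrite !mul0r addr0 subrr normr0.
rewrite -(subrKA (f (x + n%:R * h))) (le_trans (ler_normD _ _))//.
rewrite -[in leRHS]natr1 mulrDl mul1r addrC lerD//.
rewrite -lee_fin fineK ?modulus_fin_num//; apply: le_modulus.
by have -> : x + n.+1%:R * h - (x + n%:R * h) = h by rewrite -natr1; ring.
Qed.

(** The modulus controls only steps strictly shorter than [d]: the segment from
    [x] to [y] is cut into floor(|y - x| / d) + 1 equal steps. *)
Lemma distr_le_modulus f d x y : bounded_fun f -> 0 < d ->
  `|f y - f x| <= (1 + `|y - x| / d) * fine (modulus f d).
Proof.
move=> bf d0; set n := (Num.trunc (`|y - x| / d)).+1.
have q0 : 0 <= `|y - x| / d by rewrite divr_ge0// ltW.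
have /andP[n_le n_gt] := truncn_itv q0.
have n0 : 0 < n%:R :> R by rewrite ltr0n.
have hd : `|(y - x) / n%:R| < d.
  by rewrite normrM normfV (gtr0_norm n0) ltr_pdivrMr// mulrC -ltr_pdivrMr.
have stepn : x + n%:R * ((y - x) / n%:R) = y.
  by rewrite mulrC divfK ?lt0r_neq0// addrC subrK.
have := chain_le_modulus x n bf d0 hd; rewrite stepn => /le_trans; apply.
rewrite ler_wpM2r ?fine_ge0 ?modulus_ge0//.
by rewrite /n -natr1 addrC lerD2l.
Qed.

End modulus_of_continuity.

(** * Unordered sums over the integers *)

Section unordered_sums.
Context {R : realType}.
Implicit Types (a b : int -> R) (A B : {fset int}).

Lemma Zpartial_sumE a A : Zpartial_sum a A = \sum_(k <- A) a k.
Proof. by rewrite [RHS]big_seq_fsetE. Qed.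

Lemma norm_Zpartial_sum_le a b A : (forall k, `|a k| <= b k) ->
  `|Zpartial_sum a A| <= Zpartial_sum b A.
Proof.
move=> ab; rewrite !Zpartial_sumE (le_trans (ler_norm_sum _ _ _))//.
exact: ler_sum.
Qed.

Lemma Zpartial_sum_le_esum a A : (forall k, 0 <= a k) ->
  ((Zpartial_sum a A)%:E <= \esum_(k in [set: int]) (a k)%:E)%E.
Proof.
move=> a0; apply: esum_ge; exists [set` A]; first by split.
by rewrite fsbig_finite//= set_fsetK Zpartial_sumE sumEFin.
Qed.

Lemma ge0_Zpartial_sum_homo a A B : (forall k, 0 <= a k) ->
  (A `<=` B)%fset -> Zpartial_sum a A <= Zpartial_sum a B.
Proof.
move=> a0 /fsetIidPr AB.
rewrite !Zpartial_sumE [leRHS](big_fsetID _ (mem A))/=.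
have -> : [fset x in B | x \in A]%fset = A.
  by rewrite -[RHS]AB; apply/fsetP => x; rewrite !inE.
by rewrite lerDl sumr_ge0.
Qed.

(** Partial sums of a nonnegative family increase along the inclusion of
    finite sets, so they converge to their supremum. *)
Lemma ge0_bounded_Zsummable a M : (forall k, 0 <= a k) ->
  (forall A, Zpartial_sum a A <= M) -> Zsummable a.
Proof.
move=> a0 aM; set S := range (Zpartial_sum a).
have supS : has_sup S.
  split; first by exists (Zpartial_sum a fset0); exists fset0.
  by exists M => _ [A _ <-].
apply/cvg_ex; exists (sup S); apply/cvgrPdist_lt => e e0.
have [_ [A _ <-] SA] := sup_adherent e0 supS.
exists A => // B AB /=.
have BS : Zpartial_sum a B <= sup S.
  by apply: ub_le_sup; [exact: supS.2|exists B].
rewrite ger0_norm ?subr_ge0// ltrBlDr -ltrBlDl (lt_le_trans SA)//.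
exact: ge0_Zpartial_sum_homo.
Qed.

Lemma Zpartial_sumB a b A :
  Zpartial_sum (fun k => a k - b k) A = Zpartial_sum a A - Zpartial_sum b A.
Proof. by rewrite !Zpartial_sumE sumrB. Qed.

(** Both [a + b] and [b] are nonnegative with bounded partial sums, and [a] is
    their difference. *)
Lemma dominated_Zsummable a b M : (forall k, `|a k| <= b k) ->
  (forall A, Zpartial_sum b A <= M) -> Zsummable a.
Proof.
move=> ab bM; have b0 k : 0 <= b k := le_trans (normr_ge0 _) (ab k).
have cvgb : Zsummable b by exact: ge0_bounded_Zsummable bM.
have cvgab : Zsummable (fun k => a k + b k).
  apply: (@ge0_bounded_Zsummable _ (M + M)) => [k|A].
    by have := ab k; rewrite ler_norml => /andP[]; rewrite -lerBlDr sub0r.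
  rewrite (@le_trans _ _ (Zpartial_sum b A + Zpartial_sum b A))//; last first.
    exact: lerD.
  rewrite !Zpartial_sumE -big_split/=; apply: ler_sum => k _.
  by rewrite lerD2r (le_trans (ler_norm _)).
rewrite /Zsummable.
suff -> : Zpartial_sum a = fun A =>
    Zpartial_sum (fun k => a k + b k) A - Zpartial_sum b A.
  exact: is_cvgB.
apply/funext => A; rewrite -Zpartial_sumB; congr (Zpartial_sum _ A).
by apply/funext => k; rewrite addrK.
Qed.

Lemma Zsum_dist_le a b (s M : R) : Zsummable a ->
  Zpartial_sum b @ summability.totally --> s ->
  (forall A, `|Zpartial_sum (fun k => a k - b k) A| <= M) ->
  `|Zsum a - s| <= M.
Proof.
move=> cva cvb abM.
have cvd : `|(Zpartial_sum a - Zpartial_sum b) A| @[A --> summability.totally]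
    --> `|Zsum a - s|.
  by apply: cvg_norm; exact: cvgB.
apply: (closed_cvg (fun z : R => z <= M) (@closed_le _ M) _ _ cvd).
by apply: nearW => A; have := abM A; rewrite Zpartial_sumB.
Qed.

End unordered_sums.

(** * Discrete moments of order zero *)

Section kernel_sums.
Context {R : realType}.

Lemma finite_near_integers (u : R) :
  finite_set [set k : int | `|u - k%:~R| < 1].
Proof.
apply: (@sub_finite_set _ _ [set Num.floor u; Num.floor u + 1]); last first.
  exact: finite_set2.
move=> k /=; rewrite ltr_norml => /andP[uk1 uk2].
have /andP[fu uf] := floor_itv u.
have k1 : k < Num.floor u + 2.
  by rewrite -(ltr_int R) rmorphD/=; rewrite rmorphD/= in uf; lra.
have k2 : Num.floor u - 1 < k.
  by rewrite -(ltr_int R) rmorphB/=; lra.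
have [->|/eqP kf] := eqVneq k (Num.floor u); [by left|right].
lia.
Qed.

(** Finiteness is claimed at the point [u] only, where it follows from the
    moment of order 1: a term with |u - k| >= 1 grows when multiplied by
    |u - k|, and the other terms are finitely many. *)
Lemma esum_moment0_fin (phi : R -> R) (u : R) :
  (\esum_(k in [set: int])
    (`|phi (u - k%:~R)| * `|u - k%:~R| `^ 1)%:E < +oo)%E ->
  (\esum_(k in [set: int])
    (`|phi (u - k%:~R)| * `|u - k%:~R| `^ 0)%:E < +oo)%E.
Proof.
move=> m1; set F := [set k : int | `|u - k%:~R| < 1].
have finF : finite_set F := finite_near_integers u.
pose c (k : int) : \bar R := (`|phi (u - k%:~R)|)%:E.
have c0 k : (0 <= c k)%E by rewrite lee_fin.
apply: (@le_lt_trans _ _ (\esum_(k in [set: int])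
   ((`|phi (u - k%:~R)| * `|u - k%:~R| `^ 1)%:E +
    (if k \in F then c k else 0)))%E).
  apply: le_esum => k _; rewrite powRr0 mulr1 powRr1//.
  case: ifPn => kF; first by rewrite leeDr// lee_fin mulr_ge0.
  rewrite adde0 lee_fin ler_peMr//.
  by move: kF; rewrite notin_setE /F/= => /negP; rewrite -leNgt.
rewrite esumD; last 2 first.
- by move=> k _; rewrite lee_fin mulr_ge0// powR_ge0.
- by move=> k _; case: ifP.
rewrite lte_add_pinfty// -esum_mkcond.
by rewrite esum_fset// /c fsumEFin// ltry.
Qed.

End kernel_sums.

(** * Averages against a dilated kernel *)

Section kernel_average.
Context {R : realType}.
Local Notation mu := (@completed_lebesgue_measure R).
Local Notation T := (caratheodory_type ((wlength (@idfun R))^*)%mu).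

Lemma continuous_Lebesgue_measurable (h : R -> R) : continuous h ->
  measurable_fun [set: T] (h : T -> R).
Proof.
move=> ch _ A mA; apply: sub_caratheodory.
exact: (continuous_measurable_fun ch).
Qed.

Lemma L1Z (c : R) (g : R -> R) : L1 g -> L1 (fun t => c * g t).
Proof.
by move=> Lg; apply: (@integrableZl _ T R mu setT measurableT _ (EFin \o g)).
Qed.

Lemma L1D (g h : R -> R) : L1 g -> L1 h -> L1 (fun t => g t + h t).
Proof.
move=> Lg Lh.
exact: (@integrableD _ T R mu setT measurableT (EFin \o g) (EFin \o h)).
Qed.

(** What [w] times the [k]-th integral of the operator becomes under
    t = w u - k, see [kernel_averageE]; in this form the kernel no longer
    depends on [k] and [w]. *)
Definition kernel_average (psi f : R -> R) (w : R) (k : int) : R :=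
  (\int[mu]_t (psi t * f ((t + k%:~R) / w)))%R.

Lemma continuous_scaled (f : R -> R) (w c : R) : continuous f ->
  continuous (fun t => f ((t + c) / w)).
Proof.
move=> cf x.
apply: (@continuous_comp _ _ _ (fun t : R => (t + c) / w) f); last exact: cf.
by apply: cvgMl; apply: cvgD; [exact: cvg_id|exact: cvg_cst].
Qed.

Lemma L1_kernel_average (psi f : R -> R) (w : R) (k : int) :
  L1 psi -> continuous f -> bounded_fun f ->
  L1 (fun t => psi t * f ((t + k%:~R) / w)).
Proof.
move=> Lpsi cf bf.
apply: (@integrableMl _ T R mu setT measurableT (EFin \o psi)
  (fun t => f ((t + k%:~R) / w))) => //.
  exact/continuous_Lebesgue_measurable/continuous_scaled.
have [M [Mr hM]] := bf.
by exists M; split => // N MN t _ /=; exact: (hM N).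
Qed.

Lemma kernel_averageE (psi f : R -> R) (w : R) (k : int) : 0 < w ->
  L1 psi -> continuous f -> bounded_fun f ->
  L1 (fun u => psi (w * u - k%:~R) * f u) /\
  w * (\int[mu]_u (psi (w * u - k%:~R) * f u))%R = kernel_average psi f w k.
Proof.
move=> w0 Lpsi cf bf; have Lg := L1_kernel_average w k Lpsi cf bf.
have -> : (fun u => psi (w * u - k%:~R) * f u) =
    (fun t => psi t * f ((t + k%:~R) / w)) \o affine_map w (- k%:~R).
  apply/funext => u; rewrite /affine_map/= subrK.
  by rewrite [w * u / w]mulrAC divff ?mul1r// lt0r_neq0.
split; first exact: L1_affine.
exact: Rintegral_affine.
Qed.

Lemma normr_kernel_average_le (psi f : R -> R) (w M : R) (k : int) :
  L1 psi -> continuous f -> bounded_fun f -> (forall x, `|f x| <= M) ->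
  `|kernel_average psi f w k| <= M * (\int[mu]_t `|psi t|)%R.
Proof.
move=> Lpsi cf bf fM; have Lg := L1_kernel_average w k Lpsi cf bf.
have Lapsi : L1 (fun t => `|psi t|) := integrable_norm Lpsi.
apply: (le_trans (le_normr_Rintegral measurableT Lg)).
rewrite -RintegralZl//; apply: le_Rintegral => //.
- exact: (integrable_norm Lg).
- exact: L1Z.
by move=> t _; rewrite normrM mulrC ler_wpM2r.
Qed.

Lemma L1_moment1 (psi : R -> R) : L1 psi ->
  (continuous_moment 1 psi < +oo)%E -> L1 (fun t => `|t| * `|psi t|).
Proof.
move=> Lpsi m1; apply/integrableP; split.
  apply/measurable_EFinP; apply: measurable_funM.
    by apply: continuous_Lebesgue_measurable; exact: norm_continuous.
  have /integrableP[/measurable_EFinP mpsi _] := Lpsi.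
  exact: measurableT_comp.
apply: le_lt_trans m1; rewrite le_eqVlt; apply/orP; left; apply/eqP.
by apply: eq_integral => t _; rewrite gee0_abs ?powRr1// lee_fin mulr_ge0.
Qed.

(** As psi has integral one, the left-hand side is the average of
    [f ((t + k) / w) - f x] against psi; [distr_le_modulus] bounds this
    difference by (1 + |t| + |w x - k|) times the modulus, because
    w |(t + k) / w - x| = |t - (w x - k)|. *)
Lemma kernel_average_dist (psi f : R -> R) (w x : R) (k : int) : 0 < w ->
  L1 psi -> L1 (fun t => `|t| * `|psi t|) -> (\int[mu]_t psi t)%R = 1 ->
  continuous f -> bounded_fun f ->
  `|kernel_average psi f w k - f x| <=
    fine (modulus f (1 / w)) *
    ((1 + `|w * x - k%:~R|) * (\int[mu]_t `|psi t|)%R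
     + (\int[mu]_t (`|t| * `|psi t|))%R).
Proof.
move=> w0 Lpsi Ltpsi psi1 cf bf; have Lg := L1_kernel_average w k Lpsi cf bf.
have Lapsi : L1 (fun t => `|psi t|) := integrable_norm Lpsi.
set W := fine _.
have Lcpsi : L1 (fun t => f x * psi t) by exact: L1Z.
have -> : kernel_average psi f w k - f x =
    (\int[mu]_t (psi t * f ((t + k%:~R) / w) - f x * psi t))%R.
  by rewrite RintegralB// RintegralZl// psi1 mulr1.
have Ld := integrableB measurableT Lg Lcpsi.
apply: (le_trans (le_normr_Rintegral measurableT Ld)).
have Lc : L1 (fun t => (1 + `|w * x - k%:~R|) * `|psi t|) by exact: L1Z.
have Ls : L1 (fun t => (1 + `|w * x - k%:~R|) * `|psi t| + `|t| * `|psi t|).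
  exact: L1D.
rewrite -RintegralZl// -RintegralD// -RintegralZl//.
apply: le_Rintegral => //.
- exact: (integrable_norm Ld).
- exact: L1Z.
move=> t _.
have -> : psi t * f ((t + k%:~R) / w) - f x * psi t =
  psi t * (f ((t + k%:~R) / w) - f x) by ring.
have dw : 0 < 1 / w by rewrite divr_gt0.
have dist_f := distr_le_modulus x ((t + k%:~R) / w) bf dw.
rewrite normrM (le_trans (ler_wpM2l _ dist_f))//.
rewrite -/W mulrA mulrC ler_wpM2l ?fine_ge0 ?modulus_ge0//.
rewrite -mulrDl mulrC ler_wpM2r//.
rewrite -addrA lerD2l div1r invrK.
have -> : `|(t + k%:~R) / w - x| * w = `|t - (w * x - k%:~R)|.
  rewrite -[X in _ * X](gtr0_norm w0) -normrM; congr `|_|.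
  by rewrite mulrBl divfK ?lt0r_neq0//; ring.
by rewrite (le_trans (ler_normB _ _))// addrC.
Qed.

End kernel_average.

(** * The estimate in the uniform norm *)

Theorem theorem5p1 (R : realType) (phi psi f : R -> R)
    (hker : pair_of_kernels phi psi)
    (hmom : (discrete_moment 1 phi + continuous_moment 1 psi < +oo)%E)
    (hf : bounded_unif_continuous f)
    (w : R) (hw : 0 < w) :
  durrmeyer_defined phi psi w f /\
  (sup_norm (fun x => durrmeyer phi psi w f x - f x)%R
     <= durrmeyer_const phi psi * modulus f (1 / w)%R)%E.
Proof.
have [uf bf] := hf; have cf := unif_continuous_continuous uf.
have [M fM] := bounded_fun_le bf.
have Lpsi := pok_psi_L1 hker.
have dm_ge0 nu : (0 <= discrete_moment nu phi)%E.
  apply: le_trans (ereal_sup_ubound _); last by exists 0.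
  by apply: esum_ge0 => k _; rewrite lee_fin mulr_ge0// powR_ge0.
have cm_ge0 nu : (0 <= continuous_moment nu psi)%E.
  by apply: integral_ge0 => t _; rewrite lee_fin mulr_ge0// powR_ge0.
have dm1 : (discrete_moment 1 phi < +oo)%E.
  by apply: le_lt_trans hmom; rewrite leeDl.
have cm1 : (continuous_moment 1 psi < +oo)%E.
  by apply: le_lt_trans hmom; rewrite leeDr.
have Ltpsi := L1_moment1 Lpsi cm1.
have Lapsi : L1 (fun t => `|psi t|) := integrable_norm Lpsi.
have psi1 : (\int[@completed_lebesgue_measure R]_t psi t)%R = 1.
  by rewrite /Rintegral (pok_int hker).
set N0 := (\int[@completed_lebesgue_measure R]_t `|psi t|)%R.
set N1 := (\int[@completed_lebesgue_measure R]_t (`|t| * `|psi t|))%R.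
have N0E : N0%:E = continuous_moment 0 psi.
  rewrite /N0 /Rintegral fineK; last exact: integrable_fin_num.
  by apply: eq_integral => t _; rewrite powRr0 mul1r.
have N1E : N1%:E = continuous_moment 1 psi.
  rewrite /N1 /Rintegral fineK; last exact: integrable_fin_num.
  by apply: eq_integral => t _; rewrite powRr1.
have N00 : 0 <= N0 by rewrite -lee_fin N0E.
have N10 : 0 <= N1 by rewrite -lee_fin N1E.
(* The sums at one point; the finiteness of [moment 0 u] is obtained for each
   [u] separately. *)
pose moment nu u := (\esum_(k in [set: int])
  (`|phi (u - k%:~R)| * `|u - k%:~R| `^ nu)%:E)%E.
have moment_ge0 nu u : (0 <= moment nu u)%E.
  by apply: esum_ge0 => k _; rewrite lee_fin mulr_ge0// powR_ge0.
have moment_le nu u : (moment nu u <= discrete_moment nu phi)%E.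
  by apply: ereal_sup_ubound; exists u.
have moment1_fin u : moment 1 u \is a fin_num.
  by rewrite ge0_fin_numE// (le_lt_trans (moment_le _ _)).
have moment0_fin u : moment 0 u \is a fin_num.
  rewrite ge0_fin_numE//; apply: esum_moment0_fin.
  exact: le_lt_trans (moment_le 1 u) dm1.
have partial0 u A :
    Zpartial_sum (fun k => `|phi (u - k%:~R)|) A <= fine (moment 0 u).
  rewrite -lee_fin fineK//.
  have -> : moment 0 u =
      (\esum_(k in [set: int]) (`|phi (u - k%:~R)|)%:E)%E.
    by apply: eq_esum => k _; rewrite powRr0 mulr1.
  exact: Zpartial_sum_le_esum.
have partial1 u A :
    Zpartial_sum (fun k => `|phi (u - k%:~R)| * `|u - k%:~R|) A <=
    fine (moment 1 u).
  rewrite -lee_fin fineK//.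
  have -> : moment 1 u =
      (\esum_(k in [set: int]) (`|phi (u - k%:~R)| * `|u - k%:~R|)%:E)%E.
    by apply: eq_esum => k _; rewrite powRr1.
  by apply: Zpartial_sum_le_esum => k; rewrite mulr_ge0.
have termE x k : durrmeyer_term phi psi w f x k =
    phi (w * x - k%:~R) * kernel_average psi f w k.
  by rewrite /durrmeyer_term (kernel_averageE k hw Lpsi cf bf).2.
have summable x : Zsummable (durrmeyer_term phi psi w f x).
  apply: (@dominated_Zsummable _ _
    (fun k => (M * N0) * `|phi (w * x - k%:~R)|)
    ((M * N0) * fine (moment 0 (w * x)))) => [k|A].
    rewrite termE normrM mulrC ler_wpM2r//.
    exact: normr_kernel_average_le.
  rewrite Zpartial_sumE -mulr_sumr -Zpartial_sumE ler_wpM2l//.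
  by rewrite mulr_ge0// (le_trans _ (fM 0)).
split; first by split => // k; exact: (kernel_averageE k hw Lpsi cf bf).1.
have dw : 0 < 1 / w by rewrite divr_gt0.
set W := fine (modulus f (1 / w)).
have W0 : 0 <= W by rewrite fine_ge0// modulus_ge0.
apply: ge_ereal_sup => _ [x _ <-].
pose m0 := fine (moment 0 (w * x)); pose m1 := fine (moment 1 (w * x)).
(* With the finite sums at [w * x] in place of their suprema, the estimate is
   one between real numbers. *)
apply: (@le_trans _ _ ((m0 * (N0 + N1) + m1 * N0) * W)%:E); last first.
  rewrite EFinM /W fineK ?modulus_fin_num//.
  have m00 : 0 <= m0 by rewrite fine_ge0.
  have m10 : 0 <= m1 by rewrite fine_ge0.
  apply: lee_pmul => //; [by rewrite lee_fin; nra|exact: modulus_ge0|].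
  rewrite !EFinD !EFinM EFinD N0E N1E /m0 /m1 !fineK//.
  by apply: leeD; apply: lee_pmul => //; exact: adde_ge0.
rewrite lee_fin.
(* Since the values of phi sum to one, [f x] is the sum of the terms
   [phi (w * x - k) * f x], to be compared with the operator termwise. *)
apply: (@Zsum_dist_le _ _ (fun k => phi (w * x - k%:~R) * f x)) => //.
  have -> : Zpartial_sum (fun k => phi (w * x - k%:~R) * f x) =
      (fun A => Zpartial_sum (fun k => phi (w * x - k%:~R)) A * f x).
    by apply/funext => A; rewrite !Zpartial_sumE mulr_suml.
  by rewrite -[X in _ --> X]mul1r; apply: cvgMl; exact: pok_sum hker _.
move=> A.
apply: (@le_trans _ _ (Zpartial_sum (fun k =>
    W * ((N0 + N1) * `|phi (w * x - k%:~R)|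
         + N0 * (`|phi (w * x - k%:~R)| * `|w * x - k%:~R|))) A)).
  apply: norm_Zpartial_sum_le => k.
  rewrite termE -mulrBr normrM.
  have dist_avg := kernel_average_dist x k hw Lpsi Ltpsi psi1 cf bf.
  rewrite (le_trans (ler_wpM2l _ dist_avg))//.
  by rewrite -/W -/N0 -/N1 le_eqVlt; apply/orP; left; apply/eqP; ring.
rewrite Zpartial_sumE -mulr_sumr big_split/= -!mulr_sumr -!Zpartial_sumE mulrC.
rewrite ler_wpM2r// lerD//.
  by rewrite mulrC ler_wpM2r ?addr_ge0.
by rewrite mulrC ler_wpM2r.
Qed.
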